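(* Let $P$ be a reduced knot projection. If $|\tau(P)|=1$, then $2\le t(P)$, $2\le r(P)$, and $2\le y(P)$.
   Context: A knot projection is the image of a generic immersion of an unoriented circle into the sphere $S^2$ (the only singularities are transverse double points); every knot projection is assumed to have at least one double point. A double point $c$ of $P$ is nugatory if there is a simple closed curve in $S^2$ meeting $P$ only at $c$ and transverse there to both branches of $P$. A knot projection is reducible if it has a nugatory double point, and reduced otherwise. A splice at a double point removes a small neighbourhood of the double point and reconnects the four ends in one of the two planar ways without a crossing. Orient $P$ arbitrarily: the splice compatible with the orientation is the Seifert splice; the other is the non-Seifert splice, denoted $A^{-1}$ (applied alone it produces one closed curve). This does not depend on the orientation chosen. The circle number $|\tau(P)|$ is the number of circles that result from applying the non-Seifert splice $A^{-1}$ to every double point of $P$ simultaneously. Reductivities: $t(P)$ is the minimum number of splices (each of either kind), applied simultaneously at distinct double points of $P$, needed to obtain a reducible knot projection (in particular a single closed curve) from $P$; $r(P)$ is the minimum number of non-Seifert splices, applied recursively (each applied to the knot projection resulting from the previous ones, and non-Seifert with respect to it), needed to obtain a reducible knot projection from $P$; $y(P)$ is the minimum number of non-Seifert splices, applied simultaneously at distinct double points of $P$ (all non-Seifert with respect to $P$), needed to obtain a reducible knot projection from $P$. *)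

(* Defs.v *)
From mathcomp Require Import all_boot.
From mathcomp Require Import boolp.

Set Implicit Arguments.
Unset Strict Implicit.
Unset Printing Implicit Defensive.

(* A generic immersed system of circles in the oriented sphere is encoded, up
   to homeomorphism, by the 4-valent map it traces: near a double point c the
   curve has four ends, numbered counterclockwise (c, 0), ..., (c, 3) from an
   arbitrary first one, and each end is joined to another one by an arc of the
   curve without double points. Planarity is not part of this record, see
   spherical. *)
Definition dart (C : finType) : finType := (C * 'I_4)%type.

Record projection := Projection {
  crossing : finType;
  edge : dart crossing -> dart crossing;
  edgeK : involutive edge;
  edge_neq : forall x, edge x != x;
  loops : nat (* number of embedded circles without double points *)
}.

Section EndsAtACrossing.
Variable C : finType.
Implicit Type x : dart C.

Definition ccw x : dart C := (x.1, ordS x.2).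
Definition cw x : dart C := (x.1, ord_pred x.2).

(* The other end of the same branch. *)
Definition opp x : dart C := ccw (ccw x).

End EndsAtACrossing.

(* The darts of a closed curve are joined by its arcs and, at double points,
   by its branches, so closed curves are components for both matchings. *)
Definition num_curves (P : projection) : nat :=
  n_comp [rel x y : dart (crossing P) | (y == edge x) || (y == opp x)]
         {: dart (crossing P)}
  + loops P.

(* Leaving a crossing through the end x with a region on the left, the next end
   through which the boundary of that region leaves a crossing is face x. The
   orbit of x is the region containing the corner between x and ccw x. *)
Definition face (P : projection) (x : dart (crossing P)) : dart (crossing P) :=
  cw (edge x).

(* Euler's formula V + F = E + 2, meaningful when P is connected. *)
Definition spherical (P : projection) : bool :=
  #|crossing P| + fcard (@face P) {: dart (crossing P)}
    == fcard (@edge P) {: dart (crossing P)} + 2.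

Definition knot_projection (P : projection) : bool :=
  [&& 0 < #|crossing P|, num_curves P == 1 & spherical P].

(* A simple closed curve meeting P only at c, transversely to both branches,
   enters and leaves c through opposite corners and runs otherwise in a single
   region of the complement of P. *)
Definition nugatory (P : projection) (c : crossing P) : bool :=
  [exists i : 'I_4, fconnect (@face P) (c, i) (opp (c, i))].

Definition reducible (P : projection) : bool :=
  knot_projection P && [exists c : crossing P, nugatory c].

Definition reduced (P : projection) : bool :=
  knot_projection P && ~~ reducible P.

(* Leaving a crossing through x, going along the arc and straight on through
   the next double point. *)
Definition travel (P : projection) (x : dart (crossing P)) :
    dart (crossing P) :=
  opp (edge x).

(* On a knot projection: for either orientation, the curve leaves its double
   points through both x and y, or reaches them through both. *)
Definition cooriented (P : projection) (x y : dart (crossing P)) : bool :=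
  fconnect (@travel P) x y.

Variant splice_kind := Seifert | NonSeifert.

(* The end to which the splice of the given kind at x.1 joins x. The two planar
   reconnections join 0-1 and 2-3, or 1-2 and 3-0. The Seifert splice joins
   outgoing ends to incoming ones, the non-Seifert splice does not. *)
Definition turn (P : projection) (k : splice_kind) (x : dart (crossing P)) :
    dart (crossing P) :=
  let c01 := cooriented (x.1, inord 0) (x.1, inord 1) in
  let join01 := if k is NonSeifert then c01 else ~~ c01 in
  if odd x.2 (+) join01 then ccw x else cw x.

Section Splicing.
Variables (P : projection) (X : {set crossing P}).
Variable (k : crossing P -> splice_kind).

Definition strand (x : dart (crossing P)) : dart (crossing P) :=
  if x.1 \in X then turn (k x.1) x else x.

(* Follows the spliced curve from x to the first end at a crossing not in X. *)
Definition next_end (x : dart (crossing P)) : dart (crossing P) :=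
  let f := @edge P \o strand in
  head x [seq y <- traject f (f x) #|dart (crossing P)| | y.1 \notin X].

Definition spliced_edge (x : dart {c | c \notin X}) : dart {c | c \notin X} :=
  let y := next_end (val x.1, x.2) in (insubd x.1 y.1, y.2).

(* The curves of the spliced system avoiding all the remaining crossings. *)
Definition new_loops : nat :=
  let e := [rel x y | (y == edge x) || (y == strand x)] in
  n_comp e [pred x | [forall y, connect e x y ==> (y.1 \in X)]].

Lemma dart_val_inj (x y : dart {c | c \notin X}) :
  (val x.1, x.2) = (val y.1, y.2) -> x = y.
Proof.
by case: x y => [a i] [b j] [] /= ab ->; congr (_, _); apply: val_inj.
Qed.

Lemma ccwK (C : finType) : cancel (@ccw C) (@cw C).
Proof. by case=> c i; rewrite /ccw /cw /= ordSK. Qed.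

Lemma cwK (C : finType) : cancel (@cw C) (@ccw C).
Proof. by case=> c i; rewrite /ccw /cw /= ord_predK. Qed.

Lemma odd_ccw (C : finType) (x : dart C) : odd (ccw x).2 = ~~ odd x.2.
Proof. by case: x => c [[|[|[|[|]]]] //]. Qed.

Lemma odd_cw (C : finType) (x : dart C) : odd (cw x).2 = ~~ odd x.2.
Proof. by case: x => c [[|[|[|[|]]]] //]. Qed.

Lemma turn1 kd (x : dart (crossing P)) : (turn kd x).1 = x.1.
Proof. by rewrite /turn; case: ifP. Qed.

Lemma turnK kd : involutive (@turn P kd).
Proof.
move=> x; rewrite {1}/turn turn1; set b := (X in _ (+) X).
rewrite /turn -/b; case xb: (odd x.2 (+) b).
  by rewrite odd_ccw addNb xb ccwK.
by rewrite odd_cw addNb xb cwK.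
Qed.

Lemma odd_turn kd (x : dart (crossing P)) : odd (turn kd x).2 = ~~ odd x.2.
Proof. by rewrite /turn; case: ifP => _; rewrite ?odd_ccw ?odd_cw. Qed.

Lemma turn_neq kd (x : dart (crossing P)) : turn kd x != x.
Proof.
by apply/eqP => tx; have := odd_turn kd x; rewrite tx; case: (odd _).
Qed.

Lemma strandK : involutive strand.
Proof.
move=> x; rewrite {2}/strand; case: ifP => xX; rewrite /strand ?xX //.
by rewrite turn1 xX turnK.
Qed.

Lemma strand1 x : (strand x).1 = x.1.
Proof. by rewrite /strand; case: ifP; rewrite ?turn1. Qed.

Let f := @edge P \o strand.

Let f_inj : injective f.
Proof. exact: inj_comp (inv_inj (@edgeK P)) (inv_inj strandK). Qed.

Lemma next_endP x : x.1 \notin X ->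
  exists2 n, n < #|dart (crossing P)| & [/\ next_end x = iter n.+1 f x,
    (next_end x).1 \notin X
  & forall m, m < n -> (iter m.+1 f x).1 \in X].
Proof.
move=> xX; rewrite /next_end -/f; set N := #|_|.
have [o_gt0 o_le] : 0 < order f x /\ order f x <= N.
  by rewrite order_gt0 max_card.
set s := traject f (f x) N.
have hs : has (fun y => y.1 \notin X) s.
  apply/hasP; exists x => //; apply/trajectP; exists (order f x).-1.
    by rewrite -ltnS prednK.
  by rewrite -iterSr prednK // iter_order.
have := hs; rewrite has_find size_traject.
set n := find _ s => nN; exists n => //.
have nthE m : m < N -> nth x s m = iter m.+1 f x.
  by move=> mN; rewrite (set_nth_default (f x)) ?size_traject // nth_traject // -iterSr.
have -> : head x [seq y <- s | y.1 \notin X] = nth x s n.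
  by rewrite /n; elim: (s) => //= y s' IH; case: ifP.
split; first exact: nthE.
  exact: (nth_find x hs).
move=> m mn; have := before_find x mn.
by rewrite nthE ?(ltn_trans mn) // => /negbFE.
Qed.

Lemma next_end_uniq x n : n < #|dart (crossing P)| ->
  x.1 \notin X -> (iter n.+1 f x).1 \notin X ->
  (forall m, m < n -> (iter m.+1 f x).1 \in X) -> next_end x = iter n.+1 f x.
Proof.
move=> nN xX nX before; have [m mN [-> mX bm]] := next_endP xX.
case: (ltngtP m n) => [lt|lt|-> //].
  by have := before _ lt; rewrite (negbTE mX).
by have := bm _ lt; rewrite (negbTE nX).
Qed.

Lemma strand_iter n x : iter n f (strand (iter n f x)) = strand x.
Proof.
elim: n x => // n IH x; rewrite iterSr [iter n.+1 f x]iterS.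
by rewrite {2}/f /= strandK {2}/f /= edgeK IH.
Qed.

Lemma strand_out x : x.1 \notin X -> strand x = x.
Proof. by rewrite /strand => /negbTE ->. Qed.

Lemma next_endK x : x.1 \notin X -> next_end (next_end x) = x.
Proof.
move=> xX; have [n nN [yE yX before]] := next_endP xX; set y := next_end x.
have back m : m <= n.+1 -> iter m f y = strand (iter (n.+1 - m) f x).
  move=> mn; rewrite /y yE -{1}(subnKC mn) iterD.
  rewrite -(strand_iter m (iter (n.+1 - m) f x)); congr (iter m f _).
  by rewrite -iterD subnKC // strand_out // -yE.
have yx : iter n.+1 f y = x by rewrite back // subnn strand_out.
rewrite -[RHS]yx; apply: next_end_uniq; rewrite ?yx // => m mn.
rewrite back ?strand1 ?(leq_trans mn) // subSS.
rewrite -(prednK (n := n - m)) ?subn_gt0 //; apply: before.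
by rewrite prednK ?subn_gt0 // leq_subr.
Qed.

Lemma next_end_neq x : x.1 \notin X -> next_end x != x.
Proof.
move=> xX; apply/eqP => yx; have [n nN [yE yX before]] := next_endP xX.
have fx : iter n.+1 f x = x by rewrite -yE.
have back m : m <= n.+1 -> iter m f x = strand (iter (n.+1 - m) f x).
  move=> mn; rewrite -{1}fx -{1}(subnKC mn) iterD.
  rewrite -(strand_iter m (iter (n.+1 - m) f x)); congr (iter m f _).
  by rewrite -iterD subnKC // fx strand_out.
case: (odd n) (n./2) (odd_double_half n) => h /=; rewrite -addnn => nE.
  have mX : (iter h.+1 f x).1 \in X.
    by apply: before; rewrite -nE add1n ltnS leq_addr.
  have := back h.+1; rewrite -nE add1n -addSn -addnS addnK leq_addr.
  move=> /(_ isT) /esym; rewrite {1}/strand mX.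
  by move/eqP; apply/negP; apply: turn_neq.
have := back h; rewrite -nE add0n -addnS addKn leq_addr => /(_ isT) hE.
have := edge_neq (strand (iter h f x)).
by rewrite -[edge _]/(iter h.+1 f x) hE strandK eqxx.
Qed.

Lemma spliced_edgeE x :
  (val (spliced_edge x).1, (spliced_edge x).2) = next_end (val x.1, x.2).
Proof.
have [n _ [_ yX _]] := next_endP (x := (val x.1, x.2)) (valP x.1).
by rewrite /spliced_edge /= insubdK // -surjective_pairing.
Qed.

Lemma spliced_edgeK : involutive spliced_edge.
Proof.
move=> x; apply: dart_val_inj; rewrite !spliced_edgeE.
exact: (next_endK (x := (val x.1, x.2)) (valP x.1)).
Qed.

Lemma spliced_edge_neq x : spliced_edge x != x.
Proof.
apply/eqP => yx; have := next_end_neq (x := (val x.1, x.2)) (valP x.1).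
by rewrite -spliced_edgeE yx eqxx.
Qed.

(* The result of splicing simultaneously every c in X, in the way k c (kinds
   refer to P). *)
Definition splice : projection :=
  Projection spliced_edgeK spliced_edge_neq (loops P + new_loops).

End Splicing.

Definition circle_number (P : projection) : nat :=
  num_curves (splice [set: crossing P] (fun=> NonSeifert)).

(* The least n satisfying S, None standing for +oo when there is none. *)
Definition least (S : nat -> Prop) : option nat :=
  if pselect (exists n, `[< S n >]) is left ex then Some (ex_minn ex) else None.

Definition at_least (m : nat) (n : option nat) : bool :=
  if n is Some n' then m <= n' else true.

Definition t_reductivity (P : projection) : option nat :=
  least (fun n => exists (X : {set crossing P}) (k : crossing P -> splice_kind),
    #|X| = n /\ reducible (splice X k)).

Definition y_reductivity (P : projection) : option nat :=
  least (fun n => exists X : {set crossing P},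
    #|X| = n /\ reducible (splice X (fun=> NonSeifert))).

Fixpoint recursively_reducible (n : nat) (P : projection) : Prop :=
  if n is n'.+1 then
    exists c : crossing P,
      recursively_reducible n' (splice [set c] (fun=> NonSeifert))
  else reducible P.

Definition r_reductivity (P : projection) : option nat :=
  least (fun n => recursively_reducible n P).

(* Main.v *)
Require Import Defs.
From mathcomp Require Import all_boot all_fingroup.

(** Splicing nothing leaves the reduced projection [P], so only one splice, at
a double point [c], is at issue.

A Seifert splice at [c] cuts the curve in two, and the result is not a knot
projection ([num_curves_Seifert]).

Let the splice at [c] be non-Seifert and suppose that its result has a nugatory
double point [d], and so meets a simple closed curve [gamma] only there. In [P],
[gamma] may also run through [c], where the splice has opened a channel, but it
meets [P] nowhere else. Splice [P] along [gamma] at [c] and [d]: by the Jordan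
curve theorem the result is disconnected. Combinatorially, the two splices add
two vertices and lose no face, so that V - E + F is at least 4, whereas V - E +
F is at most twice the number of connected components for every pair of
permutations ([euler_inequality]). This yields a set [A] of darts, neither empty
nor full, closed under the arcs, under the turns at [c] and [d] that follow
[gamma], and under rotation about every other crossing ([spherical_cut]). The
turn at [c] is the non-Seifert one. There are two cases for the turn at [d].

- It is the non-Seifert one of [P]. Then [A] is closed under all the
  non-Seifert turns, that is, [A] is a union of circles of tau(P). So tau(P) has
  at least two circles, contrary to |tau(P)| = 1.
- It is the Seifert one. The darts of [A] leaving a crossing along the
  orientation are as many as those reaching one, as arcs match them. Seifert
  turns match them too, so the balance also holds among the darts of [A] at the
  only remaining crossing [c]. A pair of darts joined by the non-Seifert turn is
  unbalanced, hence [A] contains all the darts at [c] or none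
  ([non_Seifert_not_cut]). Then [A] is cut off from its complement at [d] alone,
  and [d] is nugatory in [P] ([nugatory_cut]), contrary to [P] being reduced. *)

Set Implicit Arguments.
Unset Strict Implicit.
Unset Printing Implicit Defensive.

(** * Euler's inequality for a pair of permutations *)

Section Invariant.
Variable D : finType.
Implicit Types (s t : {perm D}) (A : {set D}) (x y : D).

Lemma porbit_fconnect s x y : (y \in porbit s x) = fconnect s x y.
Proof.
apply/porbitP/idP => [[i ->]|/iter_findex <-].
  by rewrite permX fconnect_iter.
by exists (findex s x y); rewrite permX.
Qed.

Lemma card_porbits_fcard s : #|porbits s| = fcard s D.
Proof.
have csym : connect_sym (frel s) := fconnect_sym (@perm_inj _ s).
have -> : porbits s = [set porbit s x | x in roots (frel s)].
  apply/setP => B; apply/imsetP/imsetP => [] [x xr ->]; last by exists x.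
  exists (root (frel s) x); first exact: roots_root.
  by apply/eqP; rewrite eq_porbit_mem porbit_fconnect csym connect_root.
rewrite card_in_imset => [|x y xr yr /eqP].
  by apply: eq_card => x; rewrite !inE andbT.
rewrite eq_porbit_mem porbit_sym porbit_fconnect => /(rootP csym).
by rewrite (eqP xr) (eqP yr).
Qed.

Lemma porbits_mul_tpermr s x y :
  #|porbits (s * tperm x y)| + (x \notin porbit s y).*2
    = #|porbits s| + (x != y).
Proof.
rewrite -[in LHS]porbitsV invMg tpermV -[in RHS](porbitsV s).
by rewrite -(porbitV s) porbits_mul_tperm.
Qed.

(** There are [2 ^ k] of them, for [k] the number of orbits of the group
generated by [s] and [t]: they stand in for these orbits below. *)
Definition invariant_sets s t : {set {set D}} :=
  [set A : {set D} |
    [forall x, ((s x \in A) == (x \in A)) && ((t x \in A) == (x \in A))]].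

Lemma invariant_setsP s t A :
  reflect ({mono s : x / x \in A} /\ {mono t : x / x \in A})
          (A \in invariant_sets s t).
Proof.
rewrite inE; apply: (iffP forallP) => [sA|[sA tA] x]; last by rewrite sA tA !eqxx.
by split=> x; have /andP[/eqP ? /eqP ?] := sA x.
Qed.

Lemma card_invariant_sets1 t : 2 ^ #|porbits t| <= #|invariant_sets 1%g t|.
Proof.
rewrite -card_powerset; pose U Q := [set x | porbit t x \in (Q : {set {set D}})].
have injU : {in powerset (porbits t) &, injective U}.
  have UK Q : Q \in powerset (porbits t) -> porbit t @: U Q = Q.
    rewrite inE => /subsetP Qt; apply/setP => B; apply/imsetP/idP.
      by case=> x; rewrite inE => xQ ->.
    move=> BQ; have /imsetP[x _ def_B] := Qt _ BQ.
    by exists x; rewrite ?inE -?def_B.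
  by move=> Q R /UK {2}<- /UK {2}<- ->.
rewrite -(card_in_imset injU); apply/subset_leq_card/subsetP => _ /imsetP[Q _ ->].
apply/invariant_setsP; split=> x; rewrite ?perm1 // !inE.
by rewrite -(porbit_perm t 1 x) expg1.
Qed.

(** The darts of a map with [k] components, vertices [t], edges [s] and faces
[s * t] satisfy V - E + F <= 2k, the defect being twice the genus. In
exponential form, with [2 ^ k] invariant sets, this is an induction on [s] by
left multiplication with a transposition [(x y)], where [y = s x]. It splits an
orbit of [s], and either merges two orbits of [s * t] or splits one. When it
merges two, [x] and [y] stay in the same component; when it splits one, [k]
grows by at most one, since the symmetric difference with an invariant set that
separates [x] from [y] exchanges the sets that separate them with those that do
not. *)
Lemma euler_inequality s t :
  2 ^ (#|porbits s| + #|porbits t| + #|porbits (s * t)|)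
    <= 2 ^ #|D| * #|invariant_sets s t| ^ 2.
Proof.
have le_orb (r : {perm D}) : #|porbits r| <= #|D|.
  exact: leq_imset_card.
have [m] := ubnP (#|D| - #|porbits s|).
elim: m s => // m IH s; rewrite ltnS => le_m.
have [->|s_neq1] := eqVneq s 1%g.
  rewrite mul1g -addnA expnD addnn -muln2 expnM.
  by apply: leq_mul; rewrite ?leq_pexp2l ?leq_exp2r ?card_invariant_sets1 ?le_orb.
have /existsP[x sx_neq] : [exists x, s x != x].
  rewrite -negb_forall; apply: contra s_neq1 => /forallP s1.
  by apply/eqP/permP => x; rewrite perm1 (eqP (s1 x)).
set y := s x in sx_neq; set s' : {perm D} := (tperm x y * s)%g.
have def_s : s = (tperm x y * s')%g by rewrite mulgA tperm2 mul1g.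
have os' : #|porbits s'| = #|porbits s|.+1.
  have xy : x \in porbit s y by rewrite porbit_sym (mem_porbit s 1 x).
  have := porbits_mul_tperm s x y; rewrite xy /=.
  by rewrite eq_sym sx_neq addn0 addn1.
have ost := porbits_mul_tperm (s' * t) x y.
rewrite /= mulgA -def_s eq_sym sx_neq in ost.
have Is A : (A \in invariant_sets s t)
    = (A \in invariant_sets s' t) && ((x \in A) == (y \in A)).
  apply/invariant_setsP/andP => [[sA tA]|[/invariant_setsP[sA tA] /eqP xyA]].
    have xyA : (x \in A) = (y \in A) by rewrite /y sA.
    split; last exact/eqP.
    apply/invariant_setsP; split=> // z; rewrite permM sA.
    by case: tpermP => // ->.
  split=> // z; rewrite def_s permM sA.
  by case: tpermP => // ->.
have {}IH : 2 ^ (#|porbits s'| + #|porbits t| + #|porbits (s' * t)|)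
    <= 2 ^ #|D| * #|invariant_sets s' t| ^ 2.
  apply: IH; apply: leq_trans le_m; rewrite os'.
  by rewrite ltn_sub2l // -os' le_orb.
case: (boolP (x \in porbit (s' * t) y)) ost => [xy|xy] /= ost.
  have -> : invariant_sets s t = invariant_sets s' t.
    apply/setP => A; rewrite Is andb_idr // => /invariant_setsP[sA tA].
    have /porbitP[i ->] := xy; apply/eqP.
    elim: i => [|i IHi]; first by rewrite perm1.
    by rewrite expgSr permM permM tA sA.
  apply: leq_trans IH; rewrite leq_exp2l //.
  by rewrite os' !addSn -addnS -addn1 -ost addn0.
have NI : #|invariant_sets s' t| <= #|invariant_sets s t| * 2.
  pose sep := invariant_sets s' t :\: invariant_sets s t.
  have sub_I : invariant_sets s t \subset invariant_sets s' t.
    by apply/subsetP => A; rewrite Is => /andP[].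
  rewrite -(cardsID (invariant_sets s t)) (setIidPr sub_I) muln2 -addnn.
  rewrite leq_add2l -/sep; have [->|[A0 A0s]] := set_0Vmem sep.
    by rewrite cards0.
  pose symd (A B : {set D}) := [set z | (z \in A) (+) (z \in B)].
  have symdK B : involutive (symd B).
    by move=> A; apply/setP => z; rewrite !inE addKb.
  rewrite -(card_imset _ (inv_inj (symdK A0))).
  apply/subset_leq_card/subsetP => _ /imsetP[A As ->].
  have sepP B : B \in sep -> [/\ {mono s' : z / z \in B},
      {mono t : z / z \in B} & (x \in B) = ~~ (y \in B)].
    rewrite inE Is => /andP[+ I'B]; rewrite I'B /= => xyB.
    have /invariant_setsP[sB tB] := I'B.
    by split=> //; move: (x \in B) (y \in B) xyB => [] [].
  have [sA tA xA] := sepP _ As; have [sB tB xB] := sepP _ A0s.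
  rewrite Is; apply/andP; split; last by rewrite !inE xA xB addbN addNb negbK.
  by apply/invariant_setsP; split=> z; rewrite !inE ?sA ?sB ?tA ?tB.
rewrite -(leq_pmul2r (isT : 0 < 4)).
apply: leq_trans (_ : 2 ^ #|D| * #|invariant_sets s' t| ^ 2 <= _).
  apply: leq_trans IH; rewrite -[4]/(2 ^ 2) -expnD leq_exp2l //.
  have -> : #|porbits (s' * t)| = #|porbits (s * t)|.+1.
    by apply/succn_inj; rewrite -addn1 -ost addn2.
  by rewrite os' !addSn !addnS addn0.
by rewrite -mulnA leq_mul2l -[4]/(2 ^ 2) -expnMn leq_exp2r // NI orbT.
Qed.

(** More than one component, when V - E + F exceeds 2. *)
Lemma ex_invariant_set s t :
  #|D| + 2 < #|porbits s| + #|porbits t| + #|porbits (s * t)| ->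
  exists2 A : {set D}, A \in invariant_sets s t
    & exists x y, x \in A /\ y \notin A.
Proof.
move=> big.
have : 2 < #|invariant_sets s t|.
  rewrite ltnNge; apply/negP => small; have := euler_inequality s t.
  apply/negP; rewrite -ltnNge.
  apply: (@leq_ltn_trans (2 ^ (#|D| + 2))); last by rewrite ltn_exp2l.
  by rewrite expnD leq_mul2l (leq_exp2r _ 2) // small orbT.
move=> big_I; pose triv : {set {set D}} := [set set0; setT].
have /subsetPn[A IA] : ~~ (invariant_sets s t \subset triv).
  apply: contraL big_I => /subset_leq_card le_triv.
  by rewrite -leqNgt (leq_trans le_triv) // cards2; case: (_ == _).
rewrite !inE negb_or => /andP[/set0Pn[x xA] AT]; exists A => //; exists x.
have /subsetPn[y _ yA] : ~~ (setT \subset A) by rewrite subTset.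
by exists y.
Qed.

End Invariant.

(** * Darts and turns at a crossing *)

Section DartLemmas.
Variable C : finType.
Implicit Type x y : dart C.

Lemma oppK : involutive (@opp C).
Proof.
by case=> c [[|[|[|[|]]]] // i]; congr (_, _); apply: val_inj.
Qed.

Lemma odd_opp x : odd (opp x).2 = odd x.2.
Proof. by rewrite /opp !odd_ccw negbK. Qed.

Lemma opp_neq x : opp x != x.
Proof.
by case: x => c [[|[|[|[|]]]] // i]; rewrite xpair_eqE negb_and orbC.
Qed.

Lemma opp_cw x : opp (cw x) = ccw x.
Proof. by rewrite /opp cwK. Qed.

Lemma opp_ccw x : opp (ccw x) = cw x.
Proof. by rewrite -[RHS]oppK opp_cw. Qed.

Lemma cw_opp x : cw (opp x) = ccw x.
Proof. by rewrite -opp_ccw -/(opp x) -[ccw (opp x)]/(opp (ccw x)) oppK. Qed.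

Lemma dart_cases x y : y.1 = x.1 -> [\/ y = x, y = ccw x, y = cw x | y = opp x].
Proof.
case: x y => c i [d j] /= ->.
have eqd (k : 'I_4) : val j = val k -> (c, j) = (c, k) by move=> /val_inj ->.
case: i j eqd => [[|[|[|[|]]]] // i] [[|[|[|[|]]]] // j] eqd;
 first [by constructor 1; apply: eqd | by constructor 2; apply: eqd
      | by constructor 3; apply: eqd | by constructor 4; apply: eqd].
Qed.

(** Multiplying the rotation by the transposition of two opposite darts breaks
the crossing into two vertices of degree 2: this is the splice that joins the
corner after [x] to the opposite one. *)
Lemma cw_tperm x y : y.1 = x.1 ->
  tperm x (opp x) (cw y) = if odd x.2 (+) odd y.2 then ccw y else cw y.
Proof.
have neq_odd (z w : dart C) : odd z.2 != odd w.2 -> z != w.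
  by apply: contraNneq => ->.
move=> /dart_cases[]->; rewrite ?odd_opp ?odd_ccw ?odd_cw ?addbN ?addbb /=.
- by apply: tpermD; apply: neq_odd; rewrite ?odd_opp ?odd_cw; case: (odd _).
- by rewrite ccwK tpermL.
- by rewrite cwK -[x in cw (cw x)]oppK cw_opp ccwK tpermR.
- rewrite cw_opp.
  by apply: tpermD; apply: neq_odd; rewrite ?odd_opp ?odd_ccw; case: (odd _).
Qed.

Lemma tperm_cw_off x y : y.1 != x.1 -> tperm x (opp x) (cw y) = cw y.
Proof.
by move=> yx; apply: tpermD; apply: contraNneq yx => xy;
  rewrite -[y.1]/(cw y).1 -xy.
Qed.

Lemma fcard_cw : fcard (@cw C) {: dart C} = #|C|.
Proof.
apply/eqP; rewrite -(eqn_pmul2r (isT : 0 < 4)); apply/eqP.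
rewrite (@fcard_order_set _ _ (can_inj (@cwK C))) ?card_prod ?card_ord //.
apply/subsetP => z _; rewrite inE; apply/eqP.
apply: (@order_cycle _ _ [:: z; cw z; opp z; ccw z]); rewrite ?mem_head //=.
  by rewrite cw_opp ccwK -{2}[z]oppK cw_opp -opp_ccw ccwK !eqxx.
by case: z => d [[|[|[|[|]]]] // i]; rewrite !inE !xpair_eqE !eqxx.
Qed.

End DartLemmas.

Section Turns.
Variable P : projection.
Local Notation C := (crossing P).
Implicit Types (x y : dart C) (X : {set C}).

Lemma turn_parity k c : {u : dart C | u.1 = c & forall y, y.1 = c ->
  turn k y = if odd u.2 (+) odd y.2 then ccw y else cw y}.
Proof.
pose b := if k is NonSeifert then cooriented (c, inord 0) (c, inord 1)
          else ~~ cooriented (c, inord 0) (c, inord 1).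
by exists (c, inord b) => // y yc; rewrite /turn yc -/b addbC inordK; case: b.
Qed.

Lemma turn_cases k x : turn k x = ccw x \/ turn k x = cw x.
Proof. by rewrite /turn; case: ifP; [left|right]. Qed.

Lemma turn_opp k x : turn k (opp x) = opp (turn k x).
Proof.
rewrite /turn odd_opp; case: ifP => _; first by [].
by rewrite cw_opp opp_cw.
Qed.

Lemma turn_Seifert x : turn Seifert x = opp (turn NonSeifert x).
Proof.
by rewrite /turn addbN; case: (_ (+) _); rewrite ?opp_ccw ?opp_cw.
Qed.

Lemma face_inj : injective (@face P).
Proof. exact: inj_comp (can_inj (@cwK C)) (inv_inj (@edgeK P)). Qed.

Lemma fcard_edge : fcard (@edge P) {: dart C} * 2 = #|C| * 4.
Proof.
rewrite (@fcard_order_set _ _ (inv_inj (@edgeK P))) ?card_prod ?card_ord //.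
apply/subsetP => z _; rewrite inE; apply/eqP.
apply: (@order_cycle _ _ [:: z; edge z]); rewrite ?mem_head //=.
  by rewrite edgeK !eqxx.
by rewrite inE eq_sym edge_neq.
Qed.

(** The clockwise rotation about the vertices when each crossing of [X] is
spliced into two vertices of degree 2: unlike [splice X k], this keeps the darts
of [P]. *)
Definition spliced_cw X (k : C -> splice_kind) x :=
  if x.1 \in X then turn (k x.1) x else cw x.

(** Vertices of degree 2 do not change the regions. *)
Lemma fconnect_face_splice X k (x y : dart (crossing (splice X k))) :
  fconnect (@face (splice X k)) x y ->
  fconnect (spliced_cw X k \o @edge P) (val x.1, x.2) (val y.1, y.2).
Proof.
move=> /iter_findex <-; elim: (findex _ _ _) => //= n IH.
apply: (connect_trans IH); move: (iter n _ x) => {IH}z.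
have z_out : val z.1 \notin X := valP z.1.
have -> : (val (face z).1, (face z).2) = cw (next_end X k (val z.1, z.2)).
  by rewrite -spliced_edgeE.
have [n' _ [-> out before]] := next_endP k (x := (val z.1, z.2)) z_out.
have -> : cw (iter n'.+1 (@edge P \o strand X k) (val z.1, z.2))
    = iter n'.+1 (spliced_cw X k \o @edge P) (val z.1, z.2).
  rewrite [RHS]/=.
  have -> : forall m, m <= n' ->
      edge (iter m (spliced_cw X k \o @edge P) (val z.1, z.2))
        = iter m.+1 (@edge P \o strand X k) (val z.1, z.2).
    elim=> [|m IH] mn; first by rewrite /= strand_out.
    have inX := before _ mn; rewrite -IH ?(ltnW mn) // in inX.
    by rewrite iterS [in RHS]iterS -IH ?(ltnW mn) //= /spliced_cw /strand inX.
  - by rewrite /spliced_cw (negPf out).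
  by [].
exact: fconnect_iter.
Qed.

End Turns.

(** * Curves and their orientation *)

Lemma connect_n_comp_le1 (T : finType) (e : rel T) (a : {pred T}) x y :
  connect_sym e -> closed e a -> n_comp e a <= 1 -> x \in a -> y \in a ->
  connect e x y.
Proof.
move=> sym_e cl_a /card_le1_eqP le1 xa ya; rewrite -root_connect //.
have root_a z : z \in a -> root e z \in [predI roots e & a].
  move=> za; rewrite !inE roots_root //=.
  by rewrite -(closed_connect cl_a (connect_root e z)).
by apply/eqP/le1; apply: root_a.
Qed.

Lemma matchings_connect_sym (T : finType) (f g : T -> T) :
  involutive f -> involutive g ->
  connect_sym [rel x y | (y == f x) || (y == g x)].
Proof.
move=> fK gK; apply: sym_connect_sym => x y /=.
by rewrite ![x == _]eq_sym (can2_eq fK fK) (can2_eq gK gK).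
Qed.

(** An alternating path from [x] to [f x] could be shortened at both ends, down
to a fixed point of [f] or [g]. *)
Lemma matchings_orbit (T : finType) (f g : T -> T) x :
  involutive f -> involutive g ->
  (forall y, f y != y) -> (forall y, g y != y) ->
  ~~ fconnect (f \o g) x (f x).
Proof.
move=> fK gK f_neq g_neq; apply/negP => /iter_findex.
move: (findex _ _ _) => n; have [m] := ubnP n.
elim: m n x => // m IH [|[|n]] x le_nm /eqP.
- by rewrite /= eq_sym (negPf (f_neq x)).
- by rewrite /= (inj_eq (inv_inj fK)) (negPf (g_neq x)).
rewrite iterS iterSr /= (inj_eq (inv_inj fK)) (can2_eq gK gK) => /eqP hn.
by apply: (IH n (f (g x))); rewrite 1?ltnW // hn fK.
Qed.

Section Orientation.
Variable P : projection.
Local Notation C := (crossing P).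
Implicit Types (x y z : dart C) (A : {set dart C}).
Hypothesis P_knot : num_curves P = 1.

Lemma curve_invariant A x y :
  {mono @edge P : z / z \in A} -> {mono @opp C : z / z \in A} ->
  x \in A -> y \in A.
Proof.
move=> edgeA oppA; pose e := [rel u v : dart C | (v == edge u) || (v == opp u)].
rewrite (closed_connect (e := e) _ (y := y)) //.
  by move=> u v /= /orP[]/eqP ->; rewrite ?edgeA ?oppA.
apply: (connect_n_comp_le1 (a := {: dart C})) => //.
  exact: matchings_connect_sym (@edgeK P) (@oppK C).
by rewrite -P_knot /num_curves leq_addr.
Qed.

Lemma travel_inj : injective (@travel P).
Proof. exact: inj_comp (inv_inj (@oppK C)) (inv_inj (@edgeK P)). Qed.

Lemma cooriented_sym x y : cooriented x y = cooriented y x.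
Proof. exact: fconnect_sym travel_inj x y. Qed.

Lemma cooriented_trans x y z : cooriented x y -> cooriented x z = cooriented y z.
Proof. by move=> xy; apply: (same_connect (fconnect_sym travel_inj) xy). Qed.

Lemma cooriented_travel x y : cooriented x (travel y) = cooriented x y.
Proof. by apply/esym/(same_connect1r (fconnect_sym travel_inj)) => /=. Qed.

(** Outgoing and incoming darts are two disjoint classes, because [travel] never
leads from a dart to the opposite one, and they are the only ones, because their
union is closed under [edge] and [opp]. *)
Lemma cooriented_opp x y : cooriented x (opp y) = ~~ cooriented x y.
Proof.
have oppP z : cooriented z (opp z) = false.
  apply/negbTE; rewrite /cooriented.
  exact: (matchings_orbit z (@oppK C) (@edgeK P) (@opp_neq C) (@edge_neq P)).
pose A := [set z | cooriented x z || cooriented x (opp z)].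
have : y \in A.
  apply: (@curve_invariant A x) => [z|z|]; last by rewrite inE /cooriented connect0.
    rewrite !inE -[opp (edge z)]/(travel z) cooriented_travel orbC.
    by rewrite -[cooriented x (edge z)]cooriented_travel /travel edgeK.
  by rewrite !inE oppK orbC.
rewrite inE; case: (boolP (cooriented x y)) => //= xy _.
by rewrite (cooriented_trans _ xy) oppP.
Qed.

Lemma cooriented_edge x y : cooriented x (edge y) = ~~ cooriented x y.
Proof.
rewrite -[edge y]oppK cooriented_opp.
by rewrite -[opp (edge y)]/(travel y) cooriented_travel.
Qed.

Lemma cooriented_turn k x y :
  cooriented x (turn k y)
    = if k is NonSeifert then cooriented x y else ~~ cooriented x y.
Proof.
suff NS : cooriented y (turn NonSeifert y).
  have NSx : cooriented x (turn NonSeifert y) = cooriented x y.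
    by rewrite ![cooriented x _]cooriented_sym (cooriented_trans _ NS).
  by case: k; rewrite ?turn_Seifert ?cooriented_opp NSx.
have oppE z w : cooriented (opp z) (opp w) = cooriented z w.
  by rewrite cooriented_opp cooriented_sym cooriented_opp negbK cooriented_sym.
pose u : dart C := (y.1, inord 0).
have u1 : (y.1, inord 1) = ccw u.
  by congr (_, _); apply: val_inj; rewrite /= !inordK.
have u_odd : odd u.2 = false by rewrite /= inordK.
have turnE z : z.1 = y.1 -> turn NonSeifert z
    = if odd z.2 (+) cooriented u (ccw u) then ccw z else cw z.
  by move=> zy; rewrite /turn zy u1.
have NSu : cooriented u (turn NonSeifert u).
  rewrite turnE // u_odd; case: ifPn => //= c01.
  by rewrite -opp_ccw cooriented_opp.
have NSu' : cooriented (ccw u) (turn NonSeifert (ccw u)).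
  rewrite turnE // odd_ccw u_odd; case: ifPn => [/= c01|].
    by rewrite -/(opp u) cooriented_opp cooriented_sym.
  by rewrite ccwK cooriented_sym => /negbNE.
by have [->|->|->|->] // := dart_cases (erefl : y.1 = u.1);
  rewrite -?opp_ccw turn_opp oppE.
Qed.

Lemma cooriented_same_crossing x y :
  y.1 = x.1 -> cooriented x y -> y = x \/ y = turn NonSeifert x.
Proof.
have xx : cooriented x x by apply: connect0.
have := cooriented_turn NonSeifert x x; rewrite xx.
case: (turn_cases NonSeifert x) => -> xt /dart_cases[]->.
- by left.
- by right.
- by rewrite -opp_ccw cooriented_opp xt.
- by rewrite cooriented_opp xx.
- by left.
- by rewrite -opp_cw cooriented_opp xt.
- by right.
by rewrite cooriented_opp xx.
Qed.

End Orientation.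

(** * Closed sets of darts *)

Section ClosedSets.
Variables (P : projection).
Local Notation C := (crossing P).
Implicit Types (x y z : dart C) (A : {set dart C}) (X : {set C}).

(** A set closed under the arcs and under the way the curve goes on, at a splice
or straight on, is a union of curves of the spliced system. These curves either
meet a remaining crossing, or are among the [new_loops]. *)
Lemma spliced_curve_invariant X k A x y : num_curves (splice X k) = 1 ->
  {mono @edge P : z / z \in A} ->
  (forall z, z.1 \in X -> (turn (k z.1) z \in A) = (z \in A)) ->
  (forall z, z.1 \notin X -> (opp z \in A) = (z \in A)) ->
  x \in A -> y \in A.
Proof.
move=> one_curve edgeA turnA oppA.
pose e := [rel x y : dart C | (y == edge x) || (y == strand X k x)].
have e_sym : connect_sym e := matchings_connect_sym (@edgeK P) (@strandK P X k).
have eA : closed e A.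
  move=> u v /= /orP[]/eqP ->; first by rewrite edgeA.
  by rewrite /strand; case: ifP => // uX; rewrite turnA.
pose inner := [pred x : dart C | [forall y, connect e x y ==> (y.1 \in X)]].
have inner_closed : closed e inner.
  move=> u v uv; rewrite !inE; apply: eq_forallb => w.
  by rewrite (same_connect1 e_sym uv).
pose D' := dart (crossing (splice X k)).
pose e' := [rel u v : D' | (v == edge u) || (v == opp u)].
have e'_sym : connect_sym e'.
  exact: matchings_connect_sym (@edgeK (splice X k)) (@oppK _).
pose A' := [pred w : D' | (val w.1, w.2) \in A].
have A'_closed : closed e' A'.
  move=> u v /= /orP[]/eqP ->; rewrite !inE /=.
    rewrite spliced_edgeE.
    have [n _ [-> _ _]] := next_endP k (x := (val u.1, u.2)) (valP u.1).
    elim: n.+1 => //= n' ->.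
    by rewrite edgeA; apply: eA; rewrite /= eqxx orbT.
  by rewrite -(oppA (val u.1, u.2) (valP u.1)).
have outer z : z \notin inner -> exists w : D', (z \in A) = (w \in A').
  rewrite inE negb_forall => /existsP[w]; rewrite negb_imply => /andP[zw wX].
  exists (exist _ w.1 wX : {c | c \notin X}, w.2).
  by rewrite inE /= (closed_connect eA zw) -surjective_pairing.
have le1 : n_comp e' {: D'} + n_comp e inner <= 1.
  by rewrite -one_curve /num_curves /= leq_add2l leq_addl.
have inner_gt0 z : z \in inner -> 0 < n_comp e inner.
  move=> zI; apply/card_gt0P; exists (root e z); rewrite !inE roots_root //=.
  by have := zI; rewrite (closed_connect inner_closed (connect_root e z)).
have outer_gt0 (w : D') : 0 < n_comp e' {: D'}.
  by apply/card_gt0P; exists (root e' w); rewrite !inE roots_root.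
move=> xA; case: (boolP (x \in inner)) => [xI|/outer[x' xx']];
  case: (boolP (y \in inner)) => [yI|/outer[y' yy']].
- rewrite -(closed_connect eA (x := x)) //; apply: connect_n_comp_le1 xI yI => //.
  exact: leq_trans (leq_addl _ _) le1.
- by have := leq_add (outer_gt0 y') (inner_gt0 _ xI); rewrite leqNgt ltnS le1.
- by have := leq_add (outer_gt0 x') (inner_gt0 _ yI); rewrite leqNgt ltnS le1.
rewrite yy' -(closed_connect A'_closed (x := x')) -?xx' //.
apply: (connect_n_comp_le1 (a := {: D'})) => //.
exact: leq_trans (leq_addr _ _) le1.
Qed.

(** If [A] is cut off from its complement by a single crossing, where it has the
adjacent darts [p] and [cw p], then the region at the corner after [p] surrounds
[A]: its boundary, which leaves through [p], stays along [A] until it comes back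
to the crossing, through [cw p], and it cannot stay there for ever as it came
to [p] from the complement. *)
Lemma nugatory_cut A p :
  {mono @edge P : z / z \in A} ->
  (forall z, z.1 != p.1 -> (cw z \in A) = (z \in A)) ->
  p \in A -> cw p \in A -> ccw p \notin A -> opp p \notin A ->
  nugatory p.1.
Proof.
move=> edgeA cwA pA cwpA ccwpA oppA; apply/existsP; exists p.2.
rewrite -surjective_pairing; apply/negPn/negP => no_return.
have stay q : fconnect (@face P) p q -> q \in A.
  move=> /iter_findex <-; elim: (findex _ _ _) => //= n.
  set r := iter n _ p => rA.
  case: (eqVneq (edge r).1 p.1) => [|/cwA cwrA]; last by rewrite /face cwrA edgeA.
  have eA : edge r \in A by rewrite edgeA.
  case/dart_cases => er; rewrite er in eA.
  - by rewrite /face er.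
  - by rewrite eA in ccwpA.
  - case/negP: no_return.
    have -> : opp p = face r by rewrite /face er -[p in RHS]oppK cw_opp ccwK.
    by rewrite -[face r]/(iter n.+1 (@face P) p) fconnect_iter.
  by rewrite eA in oppA.
have := stay (edge (ccw p)); rewrite edgeA (negPf ccwpA) => /(_ _)/negP[] //.
have := fconnect1 (@face P) (edge (ccw p)).
by rewrite {2}/face edgeK ccwK fconnect_sym //; apply: face_inj.
Qed.

Hypothesis P_knot : num_curves P = 1.

(** Arcs, and Seifert turns outside [c], match the darts of [A] that are
cooriented with [u] with those that are not. So [A] has as many of both at [c]:
besides [u] and its non-Seifert neighbour, it has one of the opposite pair. *)
Lemma non_Seifert_not_cut A c u :
  {mono @edge P : z / z \in A} ->
  {mono (fun z => turn (if z.1 == c then NonSeifert else Seifert) z)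
    : z / z \in A} ->
  u.1 = c -> u \in A -> opp u \in A.
Proof.
move=> edgeA turnA uc uA.
pose N (p : pred (dart C)) b := [set z in A | p z && (cooriented u z == b)].
have balance (f : dart C -> dart C) (p : pred (dart C)) : involutive f ->
    (forall z, p (f z) = p z) -> (forall z, p z -> (f z \in A) = (z \in A)) ->
    (forall z, cooriented u (f z) = ~~ cooriented u z) ->
    #|N p true| = #|N p false|.
  move=> fK pf fA fu; rewrite -(card_imset _ (inv_inj fK)); apply: eq_card => z.
  rewrite -[z in LHS]fK mem_imset ?inE; last exact: inv_inj.
  rewrite pf fu; case: (boolP (p z)) => [/fA ->|]; rewrite ?andbF //.
  by rewrite eqb_id eqbF_neg.
have splitN b :
    #|N xpredT b| = #|N (fun z => z.1 == c) b| + #|N (fun z => z.1 != c) b|.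
  rewrite -(cardsID [set z | z.1 == c]); congr (_ + _); apply: eq_card => z;
    by rewrite !inE ?[RHS]andbA; case: (z.1 == c); rewrite ?andbF ?andbT.
have at_c :
    #|N (fun z => z.1 == c) true| = #|N (fun z => z.1 == c) false|.
  apply/eqP; rewrite -(eqn_add2r #|N (fun z => z.1 != c) true|) -splitN.
  rewrite (balance (@edge P)) //; last first.
  - exact: cooriented_edge.
  - exact: edgeK.
  rewrite (balance (turn Seifert) (fun z => z.1 != c)) -?splitN //.
  - exact: turnK.
  - by move=> z; rewrite turn1.
  - by move=> z zc; have := turnA z; rewrite (negPf zc).
  by move=> z; rewrite cooriented_turn.
have : 0 < #|N (fun z => z.1 == c) true|.
  by apply/card_gt0P; exists u; rewrite !inE uA uc /cooriented connect0 eqxx.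
rewrite at_c => /card_gt0P[z]; rewrite !inE => /and3P[zA /eqP zc /eqP uz].
have ozu : cooriented u (opp z) by rewrite cooriented_opp // uz.
have ozc : (opp z).1 = u.1 by rewrite uc.
have [<-|oz] := cooriented_same_crossing P_knot ozc ozu.
  by rewrite oppK.
have := turnA (opp u); rewrite (_ : (opp u).1 = c) // eqxx turn_opp => <-.
by rewrite -oz oppK.
Qed.

End ClosedSets.

(** * One splice *)

Section OneSplice.
Variable P : projection.
Local Notation C := (crossing P).
Implicit Types (x y z : dart C) (A : {set dart C}).

(** Let [x1] and [x2] be the outgoing darts at [c]. The spliced system goes
through the outgoing darts by [travel] followed by the transposition of [x1] and
[x2]. These lie on a single orbit of [travel], hence on two orbits of the
product. *)
Lemma num_curves_Seifert (c : C) k : num_curves P = 1 -> k c = Seifert ->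
  num_curves (splice [set c] k) != 1.
Proof.
move=> P_knot kc; apply/eqP => one_curve.
pose x1 : dart C := (c, ord0); pose x2 := turn NonSeifert x1.
have x12 : cooriented x1 x2 by rewrite /x2 cooriented_turn // /cooriented connect0.
have x2_neq : x2 != x1 := turn_neq _ _.
pose tv := perm (@travel_inj P); pose T := (tv * tperm x1 x2)%g.
have porbitE x y : (y \in porbit tv x) = cooriented x y.
  by rewrite porbit_fconnect (eq_fconnect (permE _)).
have x2_out : x2 \notin porbit T x1.
  have := porbits_mul_tpermr T x1 x2; rewrite -mulgA tperm2 mulg1.
  have := porbits_mul_tpermr tv x1 x2.
  rewrite porbitE cooriented_sym x12 /= eq_sym x2_neq porbit_sym -/T.
  case: (x2 \in _) => //=; rewrite !addn0 => ->.
  by move/eqP; rewrite -addnA -{1}[#|_|]addn0 eqn_add2l.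
have T_coor y : cooriented x1 (T y) = cooriented x1 y.
  rewrite permM (permE (@travel_inj P)) -[RHS](cooriented_travel _ y).
  by case: tpermP => // ->; rewrite ?x12 ?/cooriented ?connect0.
have A_coor y : y \in porbit T x1 -> cooriented x1 y.
  case/porbitP => i ->; elim: i => [|i IH].
    by rewrite perm1 /cooriented connect0.
  by rewrite expgSr permM T_coor.
(* The end at which the curve goes on from [y], in the spliced system. *)
pose g y := if y.1 == c then turn Seifert y else opp y.
have gK : involutive g.
  by move=> y; rewrite {2}/g; case: ifP => yc; rewrite /g ?turn1 yc ?turnK ?oppK.
have gT y : cooriented x1 y -> g (edge y) = T y.
  rewrite -cooriented_travel permM (permE (@travel_inj P)) => x1ty.
  rewrite /g -[edge y]oppK -[opp (edge y)]/(travel y) [(opp _).1]/=.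
  case: (eqVneq (travel y).1 c) => [tc|tc]; last first.
    by rewrite oppK tpermD //; apply: contraNneq tc => <-; rewrite ?turn1.
  rewrite turn_opp turn_Seifert oppK.
  have [->|->] := @cooriented_same_crossing P P_knot x1 _ tc x1ty.
    by rewrite tpermL.
  by rewrite turnK tpermR.
(* The incoming darts of the same spliced curve are added. *)
pose A := [set y | (y \in porbit T x1) || (edge y \in porbit T x1)].
have porbitT y : (T y \in porbit T x1) = (y \in porbit T x1).
  by rewrite ![_ \in porbit T x1]porbit_sym (porbit_perm T 1 y).
have gA z : g z \in A = (z \in A).
  suff sub y : y \in A -> g y \in A by apply/idP/idP => [/sub|/sub //]; rewrite gK.
  rewrite !inE => /orP[yA|eyA]; apply/orP; [right|left].
    have Tz : T (T^-1 y)%g = y by rewrite permKV.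
    have zA : (T^-1 y)%g \in porbit T x1 by rewrite -porbitT Tz.
    by rewrite -[in g y]Tz -gT ?A_coor // gK edgeK.
  by rewrite -[y](@edgeK P) gT ?A_coor // porbitT.
have /negP[] : x2 \notin A.
  rewrite inE negb_or x2_out; apply: contraL x12 => /A_coor.
  by rewrite cooriented_edge.
apply: (@spliced_curve_invariant P [set c] k A x1 x2 one_curve) => [z|z|z|].
- by rewrite !inE edgeK orbC.
- by move=> /set1P zc; rewrite zc kc -[in RHS]gA /g zc eqxx.
- by rewrite in_set1 => zc; rewrite -[in RHS]gA /g (negPf zc).
by rewrite inE porbit_id.
Qed.

(** The Jordan curve theorem for a closed curve that runs once through each of
the crossings of [u] and [x], from the corner after a dart to the opposite
corner. Splicing along it at [u] merges two regions or splits one; the two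
corners at [x] are then in the same region, which the splice at [x] splits.
In all, two vertices appear and no region is lost. *)
Lemma spherical_cut (u x : dart C) : spherical P -> u.1 != x.1 ->
  opp x \in porbit (perm (@face_inj P) * tperm u (opp u))%g x ->
  exists2 A : {set dart C},
    {mono @edge P : z / z \in A}
    /\ {mono (fun z => tperm x (opp x) (tperm u (opp u) (cw z))) : z / z \in A}
    & exists y z, y \in A /\ z \notin A.
Proof.
set phi := perm _ => sph ux x_ret.
pose e := perm (inv_inj (@edgeK P)).
pose rho := perm (can_inj (@cwK C)).
pose w := (rho * tperm u (opp u) * tperm x (opp x))%g.
have phiE : phi = (e * rho)%g by apply/permP => z; rewrite permM !permE.
have rhoX y z : z.1 = y.1 -> z \in porbit rho y.
  have rot i v : (rho ^+ i)%g v = iter i (@cw C) v.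
    by rewrite permX (eq_iter (permE _)).
  case/dart_cases=> ->; first exact: porbit_id.
  - by have := mem_porbit rho 1 (ccw y); rewrite rot /= ccwK porbit_sym.
  - by have := mem_porbit rho 1 y; rewrite rot.
  rewrite (_ : opp y = (rho ^+ 2)%g y) ?mem_porbit // rot /=.
  by rewrite -[y in RHS]oppK cw_opp ccwK.
have o_rho : #|porbits rho| = #|C|.
  by rewrite card_porbits_fcard (eq_fcard (permE _)) fcard_cw.
have ow : #|porbits w| = #|C| + 2.
  have := porbits_mul_tpermr rho u (opp u); rewrite rhoX // eq_sym opp_neq.
  have := porbits_mul_tpermr (rho * tperm u (opp u)) x (opp x).
  rewrite [x == _]eq_sym opp_neq -/w o_rho porbit_sym.
  have -> : opp x \in porbit (rho * tperm u (opp u)) x.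
    have step z : z.1 = x.1 -> (rho * tperm u (opp u))%g z = cw z.
      move=> zx; rewrite permM (permE (can_inj (@cwK C))).
      by rewrite tperm_cw_off // zx eq_sym.
    have := mem_porbit (rho * tperm u (opp u)) 2 x.
    rewrite expgS expg1 permM !step //.
    by rewrite -[x in cw (cw x)]oppK cw_opp ccwK.
  by rewrite !addn0 => -> ->; rewrite -addnA.
have oe : #|porbits e| = fcard (@edge P) {: dart C}.
  by rewrite card_porbits_fcard (eq_fcard (permE _)).
have oew : fcard (@face P) {: dart C} <= #|porbits (e * w)|.
  rewrite -(eq_fcard (permE (@face_inj P))).
  rewrite -card_porbits_fcard -/phi /w !mulgA -phiE.
  have := porbits_mul_tpermr phi u (opp u).
  have := porbits_mul_tpermr (phi * tperm u (opp u)) x (opp x).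
  rewrite [x == _]eq_sym opp_neq [u == _]eq_sym opp_neq.
  rewrite porbit_sym x_ret addn0 => ->; case: (u \in _) => /=.
    by rewrite addn0 => ->; rewrite -addnA leq_addr.
  by move/eqP; rewrite -[_.*2]/(1 + 1) addnA eqn_add2r => /eqP <-.
have [A IA nontriv] : exists2 A, A \in invariant_sets e w &
    exists y z, y \in A /\ z \notin A.
  apply: ex_invariant_set; rewrite ow oe card_prod card_ord -fcard_edge muln2 -addnn.
  apply: leq_trans (leq_add (leqnn _) oew).
  have arith (n E F : nat) : n + F = E + 2 -> E + E + 2 < E + (n + 2) + F.
    move=> nF; rewrite -[E + (n + 2) + F]addnA [n + 2 + F]addnAC nF !addnA.
    by rewrite -[X in X < _]addn0 ltn_add2l.
  exact: arith (eqP sph).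
exists A => //; have /invariant_setsP[eA wA] := IA; split=> z.
  by rewrite -[RHS]eA permE.
by rewrite -[RHS]wA !permM (permE (can_inj (@cwK C))).
Qed.

Hypotheses (P_reduced : reduced P) (P_circle : circle_number P = 1).

Lemma non_Seifert_splice_irreducible (c : C) (k : C -> splice_kind) :
  k c = NonSeifert -> ~ reducible (splice [set c] k).
Proof.
have /andP[P_knot P_irr] := P_reduced.
have {P_irr} no_nug (d : C) : ~~ nugatory d.
  by apply: contra P_irr => nug; rewrite /reducible P_knot; apply/existsP; exists d.
have {P_knot} /and3P[_ /eqP P_knot P_sph] := P_knot.
move=> kc /andP[_ /existsP[d' /existsP[i /fconnect_face_splice]]].
set x : dart C := (val d', i).
have -> : (val (opp (d', i)).1, (opp (d', i)).2) = opp x by [].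
have d_neq : x.1 != c by have := valP d'; rewrite inE.
have [u uc uturn] := turn_parity NonSeifert c.
(* The curve [gamma] goes through [x.1] along one of the two splices of [P]. *)
have [kd xturn] : exists kd, forall y, y.1 = x.1 ->
    turn kd y = if odd x.2 (+) odd y.2 then ccw y else cw y.
  have [v vd vturn] := turn_parity NonSeifert x.1.
  case: (eqVneq (odd v.2) (odd x.2)) => vx.
    by exists NonSeifert => y yd; rewrite vturn // vx.
  exists Seifert => y yd; rewrite turn_Seifert vturn //.
  have -> : odd v.2 = ~~ odd x.2 by move: vx; case: (odd v.2); case: (odd x.2).
  by rewrite addNb; case: (_ (+) _); rewrite ?opp_ccw ?opp_cw.
move=> x_ret.
have ux : u.1 != x.1 by rewrite uc eq_sym.
have [|A [edgeA wA] [y0 [z0 [y0A z0A]]]] := spherical_cut P_sph ux.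
  rewrite porbit_fconnect.
  rewrite (@eq_fconnect _ _ (spliced_cw [set c] k \o @edge P)) // => z.
  rewrite permM permE /spliced_cw /= in_set1 /face.
  case: (eqVneq (edge z).1 c) => [ec|ec]; last by rewrite tperm_cw_off ?uc.
  by rewrite cw_tperm ?uc // -uturn // ec kc.
have cA z : z.1 = c -> (turn NonSeifert z \in A) = (z \in A).
  move=> zc; rewrite -[RHS]wA cw_tperm ?uc // -uturn //.
  rewrite tpermD //; apply: contraNneq d_neq => tz;
    by rewrite -zc -(turn1 NonSeifert z) -tz.
have xA z : z.1 = x.1 -> (turn kd z \in A) = (z \in A).
  move=> zx; rewrite -[RHS]wA (tperm_cw_off (x := u)) ?zx ?uc //.
  by rewrite cw_tperm // -xturn.
have cwA z : z.1 != c -> z.1 != x.1 -> (cw z \in A) = (z \in A).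
  by move=> zc zx; rewrite -[RHS]wA !tperm_cw_off ?uc.
have oppA z : z.1 != c -> z.1 != x.1 -> (opp z \in A) = (z \in A).
  by move=> zc zx; rewrite -(cwA (opp z)) // cw_opp -(cwA (ccw z)) // ccwK.
have turnA k' z : z.1 != c -> z.1 != x.1 -> (turn k' z \in A) = (z \in A).
  move=> zc zx; case: (turn_cases k' z) => ->; rewrite ?cwA //.
  by rewrite -opp_cw oppA // cwA.
case: kd xturn xA => _ xA; last first.
  (* Non-Seifert at [x.1]: [A] is a union of circles. *)
  case/negP: z0A; pose NS := fun _ : C => NonSeifert.
  apply: (@spliced_curve_invariant P setT NS A y0 z0) => // z.
    move=> _; case: (eqVneq z.1 c) => [/cA //|zc].
    by case: (eqVneq z.1 x.1) => [/xA //|zx]; apply: turnA.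
  by rewrite inE.
(* Seifert at [x.1]: [A] is not cut at [c]. *)
have oppA' u' : u'.1 = c -> u' \in A -> opp u' \in A.
  apply: non_Seifert_not_cut => // z; case: (eqVneq z.1 c) => [/cA //|zc].
  by case: (eqVneq z.1 x.1) => [/xA //|zx]; apply: turnA.
have oppcA z : z.1 = c -> (opp z \in A) = (z \in A).
  move=> zc; apply/idP/idP => [oA|]; last exact: oppA'.
  by rewrite -[z]oppK oppA'.
have cwA' z : z.1 != x.1 -> (cw z \in A) = (z \in A).
  case: (eqVneq z.1 c) => [zc _|zc]; last exact: cwA.
  rewrite -[RHS]cA //; case: (turn_cases NonSeifert z) => -> //.
  by rewrite -opp_ccw oppcA.
have oppA2 z : z.1 != x.1 -> (opp z \in A) = (z \in A).
  by case: (eqVneq z.1 c) => [/oppcA //|]; apply: oppA.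
(* [P] being a single curve, [A] must be cut at [x.1]. *)
have [z /andP[/eqP zx /andP[zA ozA]]] :
    exists z, (z.1 == x.1) && ((z \in A) && (opp z \notin A)).
  apply/existsP; apply: contraNT z0A; rewrite negb_exists => /forallP stuck.
  apply: (curve_invariant P_knot z0 edgeA _ y0A) => z.
  case: (eqVneq z.1 x.1) => [zx|/oppA2 //]; apply/idP/idP => zA.
    by have := stuck (opp z); rewrite zA oppK [(opp z).1]zx eqxx /= negbK.
  by have := stuck z; rewrite zA zx eqxx /= negbK.
have cwz v : v.1 != z.1 -> (cw v \in A) = (v \in A).
  by rewrite zx; apply: cwA'.
have ozx : (opp z).1 = x.1 by [].
have tz := xA _ zx; have toz := xA _ ozx; rewrite turn_opp in toz.
case/negP: (no_nug z.1).
have [ez|ez] := turn_cases Seifert z; rewrite ez in tz toz.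
  by apply: (nugatory_cut (p := ccw z) edgeA cwz); rewrite ?ccwK ?tz ?toz.
by apply: (nugatory_cut edgeA cwz); rewrite -?opp_cw ?tz ?toz.
Qed.

End OneSplice.

(** * Reductivities *)

Lemma at_least_least m (S : nat -> Prop) :
  (forall n, S n -> m <= n) -> at_least m (least S).
Proof.
move=> le_m; rewrite /least; case: boolp.pselect => //= ex.
by case: ex_minnP => n /boolp.asboolP /le_m.
Qed.

Theorem theorem4 (P : projection) :
  reduced P -> circle_number P = 1 ->
  [/\ at_least 2 (t_reductivity P),
      at_least 2 (r_reductivity P) &
      at_least 2 (y_reductivity P)].
Proof.
move=> P_reduced P_circle.
have P_irr : ~ reducible P by case/andP: P_reduced => _ /negP.
have P_knot : num_curves P = 1.
  by case/andP: P_reduced => /and3P[_ /eqP].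
have irr0 k : ~ reducible (splice (set0 : {set crossing P}) k).
  case/andP=> _ /existsP[d /existsP[i /fconnect_face_splice ret]].
  apply: P_irr; case/andP: P_reduced => P_knot' _; rewrite /reducible P_knot'.
  apply/existsP; exists (val d); apply/existsP; exists i.
  rewrite -(eq_fconnect (f := spliced_cw set0 k \o @edge P)) // => z.
  by rewrite /spliced_cw /= inE.
have irr1 c k : ~ reducible (splice ([set c] : {set crossing P}) k).
  case kc: (k c); last exact: non_Seifert_splice_irreducible.
  case/andP=> /and3P[_ one_curve _] _.
  by have /negP := num_curves_Seifert P_knot kc.
have irr (X : {set crossing P}) k : reducible (splice X k) -> 2 <= #|X|.
  case: (ltngtP #|X| 1) => //.
    by rewrite ltnS leqn0 cards_eq0 => /eqP -> /irr0.
  by move/eqP/cards1P => [c ->] /irr1.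
split; apply: at_least_least.
- by move=> n [X [k [<- /irr]]].
- by case=> [/P_irr|[[c /irr1]|]].
by move=> n [X [<- /irr]].
Qed.
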